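(* Let $N\in\mathbb{N}$, $N\ge 1$, let $X=\{x_1<x_2<\dots<x_N\}\subset(0,1)$, set $x_0:=0$, $x_{N+1}:=1$, $h_i:=x_{i+1}-x_i$ for $0\le i\le N$, and let $\varepsilon>0$. Then the cardinal (Lagrange) basis $\{\ell_{1,\varepsilon,i}\}_{i=1}^N$ of $V_{1,\varepsilon}(X)=\operatorname{span}\{k_{1,\varepsilon}(\cdot,x):x\in X\}$ is given, for $1\le i\le N$ and $x\in(0,1)$, by $$\ell_{1,\varepsilon,i}(x)=\begin{cases}\dfrac{\sinh(\varepsilon(x-x_{i-1}))}{\sinh(\varepsilon h_{i-1})}, & x_{i-1}\le x<x_i,\\[2mm] \dfrac{\sinh(\varepsilon(x_{i+1}-x))}{\sinh(\varepsilon h_i)}, & x_i\le x<x_{i+1},\\[2mm] 0, & \text{otherwise.}\end{cases}$$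
   Context: For $\varepsilon>0$ the Brownian Bridge kernel $k_{1,\varepsilon}:(0,1)^2\to\mathbb{R}$ is $$k_{1,\varepsilon}(x,y)=\frac{\sinh(\varepsilon\min(x,y))\,\sinh(\varepsilon(1-\max(x,y)))}{\varepsilon\sinh(\varepsilon)},\quad x,y\in(0,1).$$ It is strictly positive definite on $(0,1)$. The cardinal (Lagrange) basis of $V_{1,\varepsilon}(X)=\operatorname{span}\{k_{1,\varepsilon}(\cdot,x):x\in X\}$ is the family of unique elements $\ell_{1,\varepsilon,i}\in V_{1,\varepsilon}(X)$, $1\le i\le N$, with $\ell_{1,\varepsilon,i}(x_j)=\delta_{ij}$ for $1\le i,j\le N$. *)

(* Defs.v *)
From mathcomp Require Import all_boot all_order all_algebra.
From mathcomp Require Import all_classical all_reals all_analysis.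

Set Implicit Arguments.
Unset Strict Implicit.
Unset Printing Implicit Defensive.

Import Order.TTheory GRing.Theory Num.Theory.
Local Open Scope classical_set_scope.
Local Open Scope ring_scope.

Notation unit_oitv R := {t : R | 0 < t < 1}.

Definition sinh (R : realType) (t : R) : R := (expR t - expR (- t)) / 2.

Definition bb_kernel (R : realType) (eps : R) (s t : unit_oitv R) : R :=
  sinh (eps * Num.min (val s) (val t))
    * sinh (eps * (1 - Num.max (val s) (val t)))
  / (eps * sinh eps).

Definition lin_span (K : pzRingType) (E : lmodType K) (A : set E) : set E :=
  [set f | exists (n : nat) (c : 'I_n -> K) (v : 'I_n -> E),
     (forall j, A (v j)) /\ f = \sum_(j < n) c j *: v j].

(* V_{1,eps}(X), with the finite set X given as the range of the family x. *)
Definition bb_space (R : realType) (eps : R) (N : nat)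
    (x : 'I_N -> unit_oitv R) : set (unit_oitv R -> R^o) :=
  lin_span [set (fun s => bb_kernel eps s t : R^o) | t in range x].

Definition is_cardinal_basis (R : realType) (T : Type) (N : nat)
    (V : set (T -> R^o)) (x : 'I_N -> T) (l : 'I_N -> T -> R^o) : Prop :=
  forall i : 'I_N, unique
    (fun f => V f /\ forall j, f (x j) = (i == j)%:R) (l i).

(* The points x_0 = 0 < x_1 < ... < x_N < x_{N+1} = 1.  As 'I_N starts at 0,
   x_{i+1} is the value of x at index i; nth returns its default value 1
   at N.+1. *)
Definition node (R : realType) (N : nat) (x : 'I_N -> unit_oitv R)
    (k : nat) : R :=
  nth 1 (0 :: [seq val (x j) | j <- enum 'I_N]) k.

Definition gap (R : realType) (N : nat) (x : 'I_N -> unit_oitv R)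
    (k : nat) : R :=
  node x k.+1 - node x k.

(* Main.v *)
Require Import Defs.
From mathcomp Require Import all_boot all_order all_algebra.
From mathcomp Require Import all_classical all_reals all_analysis.
From mathcomp Require Import ring.
Set Implicit Arguments.
Unset Strict Implicit.
Unset Printing Implicit Defensive.

Import Order.TTheory GRing.Theory Num.Theory.
Local Open Scope classical_set_scope.
Local Open Scope ring_scope.

(* The kernel is a Green's function of [u |-> eps^2 u - u''] with zero boundary
   values, so the piecewise hyperbolic hat function with nodes a < b < c is a
   combination of the kernels centred at a, b and c, whose coefficients are minus
   its derivative jumps; kernels centred at 0 or 1 vanish.  The hats are therefore in
   the span of the N kernels, and they are cardinal.  Uniqueness is linear
   algebra: the square matrix M expressing the hats in the kernels satisfies
   M K = 1 for the kernel matrix K, hence K M = 1, so that the values at the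
   nodes determine an element of the span. *)

(** A combination may use a generator several times; choosing an index for each term and adding the
    coefficients that share an index leaves one coefficient per [k j]. *)
Lemma lin_span_rangeP (K : pzRingType) (E : lmodType K) (N : nat)
    (k : 'I_N -> E) (f : E) :
  lin_span (range k) f <-> exists d : 'I_N -> K, f = \sum_j d j *: k j.
Proof.
split=> [[n [c [v [vk ->]]]]|[d ->]]; last first.
  by exists N, d, k; split=> // j; exists j.
have /choice[p pE] j : exists i, k i = v j by have [i _ <-] := vk j; exists i.
exists (fun i => \sum_(j | p j == i) c j).
rewrite (partition_big p predT) //=; apply: eq_bigr => i _.
by rewrite scaler_suml; apply: eq_bigr => j /eqP <-; rewrite pE.
Qed.

Lemma cardinal_basis_span (R : realType) (T : Type) (N : nat)
    (k : 'I_N -> T -> R^o) (x : 'I_N -> T) (l : 'I_N -> T -> R^o) :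
  (forall i, lin_span (range k) (l i)) ->
  (forall i j, l i (x j) = (i == j)%:R) ->
  is_cardinal_basis (lin_span (range k)) x l.
Proof.
move=> lk lx i; split=> [|f [/lin_span_rangeP[d ->] fx]]; first by split.
have /choice[m mE] a : exists d : 'I_N -> R, l a = \sum_j d j *: k j.
  exact/lin_span_rangeP.
have sumE (e : 'I_N -> R) t : (\sum_j e j *: k j) t = \sum_j e j * k j t.
  by rewrite fct_sumE.
pose M : 'M[R]_N := \matrix_(i, j) m i j.
pose G : 'M[R]_N := \matrix_(i, j) k i (x j).
have MG : M *m G = 1%:M.
  apply/matrixP => a b; rewrite !mxE -lx mE sumE.
  by apply: eq_bigr => j _; rewrite !mxE.
have dG : (\row_j d j) *m G = row i 1%:M.
  apply/rowP => b; rewrite !mxE -fx sumE.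
  by apply: eq_bigr => j _; rewrite !mxE.
(* Multiplying [dG] on the right by [M], the two-sided inverse of [G], recovers the coefficients of
   [f]. *)
have dM : \row_j d j = row i M.
  by rewrite -[LHS]mulmx1 -(mulmx1C MG) mulmxA dG -row_mul mul1mx.
rewrite mE; apply: eq_bigr => j _; congr (_ *: _).
by move/rowP/(_ j): dM; rewrite !mxE.
Qed.

Lemma sinh0 (R : realType) : sinh (0 : R) = 0.
Proof. by rewrite /sinh oppr0 subrr mul0r. Qed.

Lemma sinh_gt0 (R : realType) (t : R) : 0 < t -> 0 < sinh t.
Proof. by move=> t0; rewrite /sinh divr_gt0// subr_gt0 ltr_expR gtrN. Qed.

(** The three-term Plücker relation, since sinh (p - q) is the determinant of (sinh p, cosh p) and
    (sinh q, cosh q). In the exponentials it is a rational identity. *)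
Lemma sinh_plucker (R : realType) (p q r s : R) :
  sinh (p - r) * sinh (q - s) =
  sinh (p - q) * sinh (r - s) + sinh (p - s) * sinh (q - r).
Proof.
rewrite /sinh !opprB !expRD !expRN.
have := expR_gt0 p; have := expR_gt0 q; have := expR_gt0 r; have := expR_gt0 s.
move: (expR p) (expR q) (expR r) (expR s) => P Q U S s0 r0 q0 p0.
by field; rewrite !gt_eqF.
Qed.

Section Hat.
Variables (R : realType) (eps : R).
Hypothesis eps0 : 0 < eps.

Let sh (a b : R) := sinh (eps * (b - a)).

(** Defined on all reals so that the nodes 0 and 1, outside the open interval, can be centres. *)
Definition real_kernel (s t : R) : R :=
  sinh (eps * Num.min s t) * sinh (eps * (1 - Num.max s t)) / (eps * sinh eps).

Definition hat (a b c t : R) : R :=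
  if a <= t < b then sh a t / sh a b
  else if b <= t < c then sh t c / sh b c else 0.

Lemma real_kernel0 (t : R) : 0 <= t -> real_kernel t 0 = 0.
Proof. by move=> t0; rewrite /real_kernel min_r// mulr0 sinh0 !mul0r. Qed.

Lemma real_kernel1 (t : R) : t <= 1 -> real_kernel t 1 = 0.
Proof. by move=> t1; rewrite /real_kernel max_r// subrr mulr0 sinh0 mulr0 mul0r. Qed.

Let sh_neq0 (a b : R) : a < b -> sh a b != 0.
Proof. by move=> ab; rewrite gt_eqF// sinh_gt0// mulr_gt0// subr_gt0. Qed.

Let sh_plucker (p q r s : R) :
  sh r p * sh s q = sh q p * sh s r + sh s p * sh r q.
Proof. by rewrite /sh !mulrBr sinh_plucker. Qed.

Let real_kernel_le (s t : R) : s <= t ->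
  real_kernel s t = sh 0 s * sh t 1 / (eps * sh 0 1).
Proof. by move=> st; rewrite /real_kernel /sh min_l// max_r// !subr0 mulr1. Qed.

Let real_kernel_ge (s t : R) : t <= s ->
  real_kernel s t = sh 0 t * sh s 1 / (eps * sh 0 1).
Proof. by move=> st; rewrite /real_kernel /sh min_r// max_l// !subr0 mulr1. Qed.

Lemma hat_real_kernel (a b c t : R) : a < b -> b < c ->
  hat a b c t =
    - (eps / sh a b) * real_kernel t a
    + eps * sh a c / (sh a b * sh b c) * real_kernel t b
    - eps / sh b c * real_kernel t c.
Proof.
move=> ab bc; have e0 : eps != 0 by rewrite gt_eqF.
have nab := sh_neq0 ab; have nbc := sh_neq0 bc.
have n1 : sh 0 1 != 0 by exact: sh_neq0.
(* Weighted Plücker relations become zero terms; adding suitable ones to the right-hand side reduces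
   each case to a field identity. *)
have subE (u v w : R) : u = v -> w * (u - v) = 0 by move=> ->; rewrite subrr mulr0.
have abc1 w := subE _ _ w (sh_plucker 1 c b a).
have abc0 w := subE _ _ w (sh_plucker c b a 0).
have at1 w := subE _ _ w (sh_plucker 1 t a 0).
have tc1 w := subE _ _ w (sh_plucker 1 c t 0).
apply/eqP; rewrite eq_sym -subr_eq0; apply/eqP; rewrite /hat.
(* Left of [a] all three kernels share the factor [sh 0 t], and the relation between a, b, c and 1
   cancels the rest. *)
have [ta|at'] := ltP t a => /=.
  have tb := lt_trans ta ab; have tc := lt_trans tb bc.
  rewrite [b <= t]leNgt tb /= !real_kernel_le ?ltW//.
  rewrite -[RHS](abc1 (sh 0 t / (sh a b * sh b c * sh 0 1))).
  by field; rewrite n1 nab nbc.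
(* Past [a] only the kernel at [a] changes its formula; [at1] turns this change into the rising
   branch. *)
have [tb|bt] /= := ltP t b.
  have tc := lt_trans tb bc.
  rewrite real_kernel_ge// !real_kernel_le ?ltW//.
  rewrite -[RHS]addr0 -[X in _ = X + _](abc1 (sh 0 t / (sh a b * sh b c * sh 0 1))).
  rewrite -[X in _ = _ + X](at1 (sh a b * sh 0 1)^-1).
  by field; rewrite n1 nab nbc.
(* The mirror image: compared with [c <= t], only the kernel at [c] differs, and [tc1] gives the
   falling branch. *)
have [tc|ct] /= := ltP t c.
  rewrite (real_kernel_le (ltW tc)) !real_kernel_ge//.
  rewrite -[RHS]addr0 -[X in _ = X + _](abc0 (sh t 1 / (sh a b * sh b c * sh 0 1))).
  rewrite -[X in _ = _ + X](tc1 (sh b c * sh 0 1)^-1).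
  by field; rewrite n1 nab nbc.
rewrite !real_kernel_ge//.
rewrite -[RHS](abc0 (sh t 1 / (sh a b * sh b c * sh 0 1))).
by field; rewrite n1 nab nbc.
Qed.
End Hat.

Lemma nodeS (R : realType) (N : nat) (x : 'I_N -> unit_oitv R) (j : 'I_N) :
  node x j.+1 = val (x j).
Proof.
by rewrite /node /= (nth_map j) ?size_enum_ord ?ltn_ord// nth_ord_enum.
Qed.

Lemma node_last (R : realType) (N : nat) (x : 'I_N -> unit_oitv R) :
  node x N.+1 = 1.
Proof. by rewrite /node /= nth_default// size_map size_enum_ord. Qed.

Section Node.
Variables (R : realType) (N : nat) (x : 'I_N -> unit_oitv R).
Hypothesis hx : forall i j : 'I_N, (i < j)%N -> val (x i) < val (x j).

Variant node_spec (k : nat) : R -> Prop :=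
  | NodeFirst of k = 0%N : node_spec k 0
  | NodeInner (j : 'I_N) of k = j.+1 : node_spec k (val (x j))
  | NodeLast of k = N.+1 : node_spec k 1.

Lemma nodeP (k : nat) : (k <= N.+1)%N -> node_spec k (node x k).
Proof.
case: k => [|k kN]; first by constructor.
have [kN'|kN'] := ltnP k N.
  by rewrite (nodeS x (Ordinal kN')); apply: NodeInner.
have -> : k = N by apply/eqP; rewrite eqn_leq kN' -ltnS kN.
by rewrite node_last; apply: NodeLast.
Qed.

Lemma node_lt (k m : nat) : (k < m)%N -> (m <= N.+1)%N -> node x k < node x m.
Proof.
move=> km mN; have kN := leq_trans (ltnW km) mN.
case: (nodeP kN) (nodeP mN) km.
- move=> -> [->|j _ _|_ _] //.
  by have /andP[] := valP (x j).
- move=> i -> [->|j ->|_ _] //; first exact: hx.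
  by have /andP[] := valP (x i).
- by move=> -> _; rewrite ltnNge mN.
Qed.

Lemma node_ltE (k m : nat) : (k <= N.+1)%N -> (m <= N.+1)%N ->
  (node x k < node x m) = (k < m)%N.
Proof.
move=> kN mN; have [/node_lt->//|] := ltnP k m.
rewrite leq_eqVlt => /predU1P[->|mk]; first by rewrite ltxx.
by apply/negbTE; rewrite -leNgt ltW// node_lt.
Qed.

Lemma node_leE (k m : nat) : (k <= N.+1)%N -> (m <= N.+1)%N ->
  (node x k <= node x m) = (k <= m)%N.
Proof. by move=> kN mN; rewrite leNgt node_ltE// -leqNgt. Qed.

Lemma hat_node (eps : R) (i j : 'I_N) : 0 < eps ->
  hat eps (node x i) (node x i.+1) (node x i.+2) (node x j.+1) = (i == j)%:R.
Proof.
move=> e0; have i2 : (i.+2 <= N.+1)%N := ltn_ord i.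
have i1 := ltnW i2; have i0 := ltnW i1.
have j1 : (j.+1 <= N.+1)%N := ltnW (ltn_ord j).
rewrite /hat (node_leE i0 j1) (node_ltE j1 i1) (node_leE i1 j1) (node_ltE j1 i2).
have [->|ij] := eqVneq i j.
  by rewrite ltnn andbF leqnn ltnSn divff// gt_eqF// sinh_gt0// mulr_gt0// subr_gt0
    node_lt// ltnS ltn_ord.
(* For distinct indices only the first branch can apply, and only at i = j + 1, the left end of the
   hat, where the numerator is sinh 0. *)
rewrite !ltnS -!eqn_leq (inj_eq val_inj) (negbTE ij).
by case: eqP => // ->; rewrite subrr mulr0 sinh0 mul0r.
Qed.

(** Covering the end nodes too, with zero coefficients, spares the hats next to the boundary a
    separate treatment. *)
Lemma real_kernel_node_span (eps : R) (k : nat) : (k <= N.+1)%N ->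
  exists d : 'I_N -> R, (fun t : unit_oitv R => real_kernel eps (val t) (node x k) : R^o)
    = \sum_j d j *: (fun t => bb_kernel eps t (x j) : R^o).
Proof.
have zero (f : unit_oitv R -> R^o) : f = (fun=> 0) ->
    exists d : 'I_N -> R, f = \sum_j d j *: (fun t => bb_kernel eps t (x j) : R^o).
  by move=> ->; exists (fun=> 0); rewrite big1// => j _; rewrite scale0r.
case/nodeP => [_|j _|_].
- apply: zero; apply/funext => t; rewrite real_kernel0//.
  by have /andP[/ltW] := valP t.
- exists (fun i => (i == j)%:R).
  rewrite (bigD1 j)//= eqxx scale1r big1 ?addr0// => i /negbTE->.
  by rewrite scale0r.
- apply: zero; apply/funext => t; rewrite real_kernel1//.
  by have /andP[_ /ltW] := valP t.
Qed.

Lemma hat_span (eps : R) (i : 'I_N) : 0 < eps ->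
  lin_span (range (fun j => (fun t => bb_kernel eps t (x j)) : unit_oitv R -> R^o))
    (fun t => hat eps (node x i) (node x i.+1) (node x i.+2) (val t)).
Proof.
move=> e0; have iN : (i.+2 <= N.+1)%N := ltn_ord i; apply/lin_span_rangeP.
have [d0 d0E] := real_kernel_node_span eps (ltnW (ltnW iN)).
have [d1 d1E] := real_kernel_node_span eps (ltnW iN).
have [d2 d2E] := real_kernel_node_span eps iN.
pose f k : unit_oitv R -> R^o := fun t => real_kernel eps (val t) (node x k).
have -> : (fun t : unit_oitv R =>
    hat eps (node x i) (node x i.+1) (node x i.+2) (val t)) =
    - (eps / sinh (eps * (node x i.+1 - node x i))) *: f i
    + (eps * sinh (eps * (node x i.+2 - node x i))
        / (sinh (eps * (node x i.+1 - node x i))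
           * sinh (eps * (node x i.+2 - node x i.+1)))) *: f i.+1
    + - (eps / sinh (eps * (node x i.+2 - node x i.+1))) *: f i.+2.
  apply/funext => t; rewrite (hat_real_kernel e0 (val t) _ (node_lt (ltnSn i.+1) iN)).
    by rewrite -[- (_ / _ * _)]mulNr.
  exact: node_lt (ltnSn i) (ltnW iN).
(* Only linearity remains: [u], [v], [w] are the coefficients at the left, middle and right node. *)
move: (- _) (_ / _) (- _) => w v u.
exists (fun j => u * d0 j + v * d1 j + w * d2 j).
rewrite /f d0E d1E d2E !scaler_sumr -!big_split; apply: eq_bigr => j _ /=.
by rewrite !scalerDl !scalerA.
Qed.

End Node.

(* The index i : 'I_N stands for the 1-based index i.+1, so x_{i-1}, x_i and
   x_{i+1} are node x i, node x i.+1 and node x i.+2. *)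
Theorem mainTheorem1 (R : realType) (N : nat) (hN : (1 <= N)%N)
    (x : 'I_N -> unit_oitv R)
    (hx : forall i j : 'I_N, (i < j)%N -> val (x i) < val (x j))
    (eps : R) (heps : 0 < eps) :
  is_cardinal_basis (bb_space eps x) x
    (fun (i : 'I_N) (t : unit_oitv R) =>
       if node x i <= val t < node x i.+1 then
         sinh (eps * (val t - node x i)) / sinh (eps * gap x i)
       else if node x i.+1 <= val t < node x i.+2 then
         sinh (eps * (node x i.+2 - val t)) / sinh (eps * gap x i.+1)
       else 0).
Proof.
(* The stated formula is, by unfolding, [hat] at three consecutive nodes. *)
rewrite /bb_space image_comp; apply: cardinal_basis_span => [i|i j].
  exact: hat_span.
by rewrite -(hat_node hx i j heps) (nodeS x j).
Qed.
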